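(* Let $k$ be an algebraically closed field of arbitrary characteristic and let $H$ be a finite-dimensional cosemisimple Hopf algebra over $k$. Then any left $H$-module coalgebra $C$ which is isomorphic to the left regular $H$-module as an $H$-module, and such that the corresponding $H^*$-extension $k\subset C^*$ is Galois, is cosemisimple.
   Context: Let $\Delta,\varepsilon$ be the comultiplication and counit of $H$. A left $H$-module coalgebra is a coalgebra $(C,\Delta_C,\varepsilon_C)$ which is a left $H$-module with $\Delta_C(h\cdot c)=\Delta(h)\cdot\Delta_C(c)$ and $\varepsilon_C(h\cdot c)=\varepsilon(h)\varepsilon_C(c)$ for all $h\in H$, $c\in C$. For such $C$, the dual algebra $A=C^*$ is a left $H^*$-comodule algebra: the coaction $\gamma:A\to H^*\otimes A$, $\gamma(a)=a_{(-1)}\otimes a_{(0)}$, is determined by $\langle a,h\cdot c\rangle=\langle a_{(-1)},h\rangle\langle a_{(0)},c\rangle$ for $h\in H$, $c\in C$. The $H^*$-extension $k\subset A$ is Galois if the coinvariants $\{a\in A:\gamma(a)=1\otimes a\}$ equal $k$ and the map $A\otimes_k A\to H^*\otimes_k A$, $a\otimes b\mapsto(1\otimes a)\gamma(b)$, is bijective. *)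

(* Defs.v *)
From HB Require Import structures.
From mathcomp Require Import all_boot all_order all_algebra all_field.

Set Implicit Arguments.
Unset Strict Implicit.
Unset Printing Implicit Defensive.

Import GRing.Theory VectorInternalTheory.
Local Open Scope ring_scope.

(* The tensor product of two finite-dimensional spaces is modelled, relative  *)
(* to the coordinate isomorphisms v2r, by matrices, with u ⊗ v = u^T v. It is *)
(* used through tens and the linear extension tlift; its universal property   *)
(* is given by tliftE and tlift_unique below.                                 *)
Section Tensor.
Variable k : fieldType.
Implicit Types U V W : vectType k.

Definition tensor U V := 'M[k]_(dim U, dim V).

Definition tens U V (u : U) (v : V) : tensor U V := (v2r u)^T *m v2r v.

Lemma tens_linearl U V (v : V) : linear (fun u : U => tens u v).
Proof.
by move=> x y z; rewrite /tens linearP linearD linearZ /= mulmxDl scalemxAl.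
Qed.

Lemma tens_linearr U V (u : U) : linear (fun v : V => tens u v).
Proof. by move=> x y z; rewrite /tens linearP mulmxDr scalemxAr. Qed.

Definition std_basis V (i : 'I_(dim V)) : V := r2v (delta_mx 0 i).

(* Meaningful when f is bilinear (tliftE). *)
Definition tlift U V W (f : U -> V -> W) : 'Hom(tensor U V, W) :=
  linfun (fun t : tensor U V =>
    \sum_i \sum_j (t : 'M[k]__) i j *: f (std_basis i) (std_basis j)).

(* The operation (u1 ⊗ v1, u2 ⊗ v2) |-> f u1 u2 ⊗ g v1 v2.                    *)
Definition tmap2 U1 U2 U3 V1 V2 V3 (f : U1 -> U2 -> U3) (g : V1 -> V2 -> V3)
    (x : tensor U1 V1) (y : tensor U2 V2) : tensor U3 V3 :=
  tlift (fun u1 v1 => tlift (fun u2 v2 => tens (f u1 u2) (g v1 v2)) y) x.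

Definition tassoc U V W :
    'Hom(tensor (tensor U V) W, tensor U (tensor V W)) :=
  tlift (fun x w => tlift (fun u v => tens u (tens v w)) x).

(* The subspace D ⊗ E of U ⊗ V. *)
Definition tensorv U V (D : {vspace U}) (E : {vspace V}) :
    {vspace tensor U V} :=
  <<[seq tens d e | d <- vbasis D, e <- vbasis E]>>%VS.

Lemma std_basisE V (v : V) : v = \sum_i v2r v 0 i *: std_basis i.
Proof.
apply: (can_inj v2rK); rewrite [LHS]row_sum_delta linear_sum /=.
by apply: eq_bigr => i _; rewrite linearZ /= r2vK.
Qed.

Lemma tliftM U V W (f : U -> V -> W) (t : tensor U V) :
  tlift f t =
  \sum_i \sum_j (t : 'M[k]__) i j *: f (std_basis i) (std_basis j).
Proof.
pose F := fun t : tensor U V =>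
  \sum_i \sum_j (t : 'M[k]__) i j *: f (std_basis i) (std_basis j).
have linF : linear F.
  move=> a x y; rewrite /F scaler_sumr -big_split; apply: eq_bigr => i _ /=.
  rewrite scaler_sumr -big_split; apply: eq_bigr => j _ /=.
  by rewrite !mxE scalerDl scalerA.
pose FL := GRing.isLinear.Build _ _ _ _ F linF.
pose FF : {linear tensor U V -> W} := HB.pack F FL.
exact: (lfunE FF).
Qed.

Lemma tensE U V (u : U) (v : V) i j :
  (tens u v : 'M[k]__) i j = v2r u 0 i * v2r v 0 j.
Proof. by rewrite /tens mxE big_ord1 mxE. Qed.

Lemma tliftE U V W (f : U -> V -> W) :
  (forall v, linear (f^~ v)) -> (forall u, linear (f u)) ->
  forall u v, tlift f (tens u v) = f u v.
Proof.
move=> linl linr u v.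
pose FLl v := GRing.isLinear.Build _ _ _ _ (f^~ v) (linl v).
pose Fl v : {linear U -> W} := HB.pack (f^~ v) (FLl v).
pose FLr u := GRing.isLinear.Build _ _ _ _ (f u) (linr u).
pose Fr u : {linear V -> W} := HB.pack (f u) (FLr u).
rewrite tliftM [in RHS](std_basisE u) -[RHS]/(Fl v _) linear_sum.
apply: eq_bigr => i _; rewrite linearZ /= [in RHS](std_basisE v).
rewrite -[f _ (\sum_j _)]/(Fr (std_basis i) _) linear_sum scaler_sumr.
by apply: eq_bigr => j _; rewrite linearZ tensE scalerA.
Qed.

Lemma tens_span U V (t : tensor U V) :
  t = \sum_i \sum_j (t : 'M[k]__) i j *: tens (std_basis i) (std_basis j).
Proof.
rewrite [LHS]matrix_sum_delta; apply: eq_bigr => i _; apply: eq_bigr => j _.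
congr (_ *: _); apply/matrixP => i' j'.
by rewrite tensE /std_basis !r2vK !mxE -natrM mulnb.
Qed.

Lemma tlift_unique U V W (F G : 'Hom(tensor U V, W)) :
  (forall u v, F (tens u v) = G (tens u v)) -> F = G.
Proof.
move=> eqFG; apply/lfunP => t; rewrite (tens_span t) !linear_sum.
apply: eq_bigr => i _; rewrite !linear_sum; apply: eq_bigr => j _.
by rewrite !linearZ /= eqFG.
Qed.

End Tensor.

Section Coalgebras.
Variable k : fieldType.

Record coalgebra (C : vectType k) := Coalgebra {
  comul : 'Hom(C, tensor C C);
  counit : 'Hom(C, k^o);
  comulA : forall c,
    tassoc C C C (tlift (fun a b => tens (comul a) b) (comul c)) =
    tlift (fun a b => tens a (comul b)) (comul c);
  counitl : forall c,
    tlift (fun a b : C => (counit a : k) *: b) (comul c) = c;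
  counitr : forall c,
    tlift (fun a b : C => (counit b : k) *: a) (comul c) = c
}.

Section Cosemisimple.
Variables (C : vectType k) (sC : coalgebra C).

Definition subcoalgebra (D : {vspace C}) : Prop :=
  (comul sC @: D <= tensorv D D)%VS.

Definition simple_subcoalgebra (D : {vspace C}) : Prop :=
  [/\ subcoalgebra D, D <> 0%VS &
      forall E, subcoalgebra E -> (E <= D)%VS -> E = 0%VS \/ E = D].

(* As C is finite-dimensional, the family of summands is necessarily finite.  *)
Definition cosemisimple : Prop :=
  exists (n : nat) (D : 'I_n -> {vspace C}),
    [/\ forall i, simple_subcoalgebra (D i),
        directv (\sum_i D i) & (\sum_i D i)%VS = fullv].

(* The product of the dual algebra C^*; its unit is counit sC.                *)
Definition conv (a b : 'Hom(C, k^o)) : 'Hom(C, k^o) :=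
  (tlift (fun c d : C => (a c : k) * b d : k^o) \o comul sC)%VF.

End Cosemisimple.

Record hopf_algebra (H : falgType k) := HopfAlgebra {
  hopf_coalgebra :> coalgebra H;
  comulM : forall g h, comul hopf_coalgebra (g * h) =
    tmap2 *%R *%R (comul hopf_coalgebra g) (comul hopf_coalgebra h);
  comul1 : comul hopf_coalgebra 1 = tens 1 1;
  counitM : forall g h, counit hopf_coalgebra (g * h) =
    (counit hopf_coalgebra g : k) * counit hopf_coalgebra h;
  counit1 : counit hopf_coalgebra 1 = 1;
  antipode : 'End(H);
  antipodel : forall h,
    tlift (fun a b => antipode a * b) (comul hopf_coalgebra h) =
    (counit hopf_coalgebra h : k) *: 1;
  antipoder : forall h,
    tlift (fun a b => a * antipode b) (comul hopf_coalgebra h) =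
    (counit hopf_coalgebra h : k) *: 1
}.

Record hmodule (H : falgType k) (C : vectType k) := HModule {
  hact :> 'Hom(H, 'End(C));
  hact1 : forall c, hact 1 c = c;
  hactM : forall g h c, hact (g * h) c = hact g (hact h c)
}.

Definition regular_iso (H : falgType k) (C : vectType k) (m : hmodule H C) : Prop :=
  exists2 f : 'Hom(H, C), bijective f & forall h x, f (h * x) = m h (f x).

Record module_coalgebra (H : falgType k) (sH : hopf_algebra H)
    (C : vectType k) := ModuleCoalgebra {
  mc_coalgebra :> coalgebra C;
  mc_module : hmodule H C;
  comul_act : forall h c, comul mc_coalgebra (mc_module h c) =
    tmap2 (fun h c => mc_module h c) (fun h c => mc_module h c)
      (comul sH h) (comul mc_coalgebra c);
  counit_act : forall h c, counit mc_coalgebra (mc_module h c) =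
    (counit sH h : k) * counit mc_coalgebra c
}.

Definition std_dual (V : vectType k) (i : 'I_(dim V)) : 'Hom(V, k^o) :=
  linfun (fun v : V => v2r v 0 i : k^o).

Definition tpair (U V : vectType k)
    (t : tensor 'Hom(U, k^o) 'Hom(V, k^o)) (u : U) (v : V) : k :=
  tlift (fun (f : 'Hom(U, k^o)) (g : 'Hom(V, k^o)) =>
    (f u : k) * g v : k^o) t.

Section Galois.
Variables (H : falgType k) (sH : hopf_algebra H).
Variables (C : vectType k) (sC : module_coalgebra sH C).
Let A := 'Hom(C, k^o).
Let Hd := 'Hom(H, k^o).

(* The coaction gamma : C^* -> H^* ⊗ C^*; it is the unique element satisfying *)
(* <gamma a, h ⊗ c> = <a, h · c> (coactionE and coaction_unique).             *)
Definition coaction (a : A) : tensor Hd A :=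
  \sum_(i < dim H) \sum_(j < dim C)
    (a (mc_module sC (std_basis i) (std_basis j)) : k) *:
      tens (std_dual i) (std_dual j).

Definition galois_map : 'Hom(tensor A A, tensor Hd A) :=
  tlift (fun a b : A =>
    tmap2 (conv sH) (conv sC) (tens (counit sH) a) (coaction b)).

Definition galois_extension : Prop :=
  (forall a : A, coaction a = tens (counit sH : Hd) a <->
                 exists x : k, a = x *: counit sC) /\
  bijective galois_map.

End Galois.

Lemma std_dualE (V : vectType k) i (v : V) : std_dual i v = v2r v 0 i.
Proof.
pose F := fun v : V => v2r v 0 i : k^o.
have linF : linear F by move=> a x y; rewrite /F linearP !mxE.
pose FL := GRing.isLinear.Build _ _ _ _ F linF.
pose FF : {linear V -> k^o} := HB.pack F FL.
exact: (lfunE FF).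
Qed.

Lemma tpair_tens (U V : vectType k) (f : 'Hom(U, k^o)) (g : 'Hom(V, k^o)) u v :
  tpair (tens f g) u v = (f u : k) * g v.
Proof.
rewrite /tpair tliftE // => [g' a f1 f2|f' a g1 g2].
  by rewrite !lfunE /= !lfunE /= mulrDl /GRing.scale /= mulrA.
by rewrite !lfunE /= !lfunE /= mulrDr /GRing.scale /= mulrCA.
Qed.

Lemma coactionE (H : falgType k) (sH : hopf_algebra H) (C : vectType k)
    (sC : module_coalgebra sH C) (a : 'Hom(C, k^o)) h c :
  tpair (coaction sC a) h c = a (mc_module sC h c).
Proof.
rewrite /tpair /coaction linear_sum /= [in RHS](std_basisE h).
rewrite linear_sum sum_lfunE linear_sum; apply: eq_bigr => i _.
rewrite linear_sum /= linearZ /= scale_lfunE linearZ /= [in RHS](std_basisE c).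
rewrite !linear_sum /=; apply: eq_bigr => j _; rewrite !linearZ /=.
rewrite [tlift _ _](tpair_tens (std_dual i) (std_dual j) h c) !std_dualE.
by rewrite /GRing.scale /= mulrC -mulrA mulrCA.
Qed.

Lemma coaction_unique (H : falgType k) (sH : hopf_algebra H) (C : vectType k)
    (sC : module_coalgebra sH C) (a : 'Hom(C, k^o))
    (t : tensor 'Hom(H, k^o) 'Hom(C, k^o)) :
  (forall h c, tpair t h c = a (mc_module sC h c)) -> t = coaction sC a.
Proof.
have dualE (V : vectType k) (f : 'Hom(V, k^o)) :
    f = \sum_i (f (std_basis i) : k) *: std_dual i.
  apply/lfunP => v; rewrite [in LHS](std_basisE v) linear_sum sum_lfunE.
  apply: eq_bigr => i _; rewrite linearZ scale_lfunE /= std_dualE.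
  by rewrite /GRing.scale /= mulrC.
suff rec (s : tensor 'Hom(H, k^o) 'Hom(C, k^o)) : s = \sum_i \sum_j
    tpair s (std_basis i) (std_basis j) *: tens (std_dual i) (std_dual j).
  move=> eq_t; rewrite [LHS]rec /coaction; apply: eq_bigr => i _.
  by apply: eq_bigr => j _; rewrite eq_t.
pose R (s : tensor 'Hom(H, k^o) 'Hom(C, k^o)) :=
  \sum_i \sum_j tpair s (std_basis i) (std_basis j) *:
     tens (std_dual i) (std_dual j) : tensor 'Hom(H, k^o) 'Hom(C, k^o).
have linR : linear R.
  move=> x y z; rewrite /R scaler_sumr -big_split; apply: eq_bigr => i _ /=.
  rewrite scaler_sumr -big_split; apply: eq_bigr => j _ /=.
  by rewrite /tpair linearP scalerDl scalerA.
pose RL := GRing.isLinear.Build _ _ _ _ R linR.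
pose RR : {linear tensor 'Hom(H, k^o) 'Hom(C, k^o) -> _} := HB.pack R RL.
suff /lfunP/(_ s) : \1%VF = linfun RR by rewrite id_lfunE lfunE.
apply: tlift_unique => f g; rewrite id_lfunE lfunE /= /R.
pose Tl v := GRing.isLinear.Build _ _ _ _ _
  (@tens_linearl k 'Hom(H, k^o) 'Hom(C, k^o) v).
pose TL v : {linear 'Hom(H, k^o) -> tensor _ _} :=
  HB.pack (fun u => tens u v) (Tl v).
pose Tr u := GRing.isLinear.Build _ _ _ _ _
  (@tens_linearr k 'Hom(H, k^o) 'Hom(C, k^o) u).
pose TR u : {linear 'Hom(C, k^o) -> tensor _ _} :=
  HB.pack (fun v => tens u v) (Tr u).
rewrite [in LHS](dualE _ f) -[LHS]/(TL g _) linear_sum; apply: eq_bigr => i _.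
rewrite linearZ /= [in LHS](dualE _ g) -[tens _ (\sum__ _)]/(TR (std_dual i) _).
rewrite linear_sum scaler_sumr; apply: eq_bigr => j _.
by rewrite linearZ /= scalerA tpair_tens.
Qed.

End Coalgebras.

(* Main.v *)
From HB Require Import structures.
Require Import Defs.
From mathcomp Require Import all_boot all_order all_algebra all_field.
From Stdlib Require Import Classical.

Set Implicit Arguments.
Unset Strict Implicit.
Unset Printing Implicit Defensive.

Import GRing.Theory VectorInternalTheory.
Local Open Scope ring_scope.

(** Write A = C^* for the dual algebra.  The Galois property produces an
explicit separability idempotent of A, and a separable algebra is semisimple,
so C is cosemisimple.

- An integral.  As H is cosemisimple and 1 is grouplike, the line k1 is one of
  the simple summands of H.  The projection onto it along the other summands
  is a functional L with L(1) = 1 and L * f = f(1) L for every f in H^*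
  (cosemisimple_integral).

- An idempotent.  The Galois map beta(x ⊗ y) = (1 ⊗ x) gamma(y) satisfies
  beta(a x ⊗ y) = (1 ⊗ a) beta(x ⊗ y) and beta(x ⊗ y a) = beta(x ⊗ y) gamma(a).
  Let e be the preimage of L ⊗ 1.  Then beta(a e) = L ⊗ a, and
  beta(e a) = L a_(-1) ⊗ a_(0) = L ⊗ a, so a e = e a as beta is injective;
  applying the evaluation at 1 of H to beta(e) = L ⊗ 1 shows that the product
  of the two legs of e is 1 (galois_separable).  The tensors of H^* ⊗ A are
  compared through their pairing with H × C, in which beta(e) becomes
  (h, c) |-> e(c1, h c2) and the computations are in Sweedler notation.

- Averaging.  Subcoalgebras of C are its sub-bimodules for the two actions
  lhit and rhit of A (subcoalgebraP).  Averaging a linear projection onto a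
  subcoalgebra with e, once for each action, makes it a bimodule map, whose
  kernel is a complementary subcoalgebra (subcoalgebra_complement).  An
  induction on the dimension then splits C into simple subcoalgebras
  (separable_cosemisimple). *)

(** * Calculus of linear maps out of a tensor product *)

Section TensorCalculus.
Variable k : fieldType.
Implicit Types U V W X : vectType k.

(** Here tlift f t plays the role of a Sweedler sum: f is applied to the two
legs of t.  As tlift f is defined by values on a basis, sums of this form can
be rewritten for an arbitrary function f; bilinearity matters only when t is
a pure tensor, to evaluate them by tliftE. *)
Lemma eq_tlift U V W (f g : U -> V -> W) : f =2 g -> tlift f =1 tlift g.
Proof.
move=> eqfg t; rewrite !tliftM; apply: eq_bigr => i _.
by apply: eq_bigr => j _; rewrite eqfg.
Qed.

Lemma lfun_tlift U V W X (G : 'Hom(W, X)) (f : U -> V -> W) t :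
  G (tlift f t) = tlift (fun u v => G (f u v)) t.
Proof.
rewrite !tliftM linear_sum; apply: eq_bigr => i _ /=.
by rewrite linear_sum; apply: eq_bigr => j _ /=; rewrite linearZ.
Qed.

Lemma tlift_lfunE U V W X (F : U -> V -> 'Hom(W, X)) t w :
  tlift F t w = tlift (fun u v => F u v w) t.
Proof.
rewrite !tliftM sum_lfunE; apply: eq_bigr => i _ /=.
by rewrite sum_lfunE; apply: eq_bigr => j _ /=; rewrite scale_lfunE.
Qed.

Lemma tlift_exchange U V U' V' W (f : U -> V -> U' -> V' -> W) s t :
  tlift (fun u v => tlift (f u v) s) t =
  tlift (fun u' v' => tlift (fun u v => f u v u' v') t) s.
Proof.
have pairE U1 V1 W1 (g : U1 -> V1 -> W1) (r : tensor U1 V1) : tlift g r =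
    \sum_(p : 'I_(dim U1) * 'I_(dim V1))
      (r : 'M[k]__) p.1 p.2 *: g (std_basis p.1) (std_basis p.2).
  by rewrite tliftM pair_bigA.
rewrite !pairE; under eq_bigr do rewrite pairE scaler_sumr.
rewrite exchange_big; apply: eq_bigr => p _ /=.
rewrite pairE scaler_sumr; apply: eq_bigr => q _.
by rewrite !scalerA mulrC.
Qed.

Lemma tlift_linear U V W X (f : X -> U -> V -> W) t :
  (forall u v, linear (fun x => f x u v)) -> linear (fun x => tlift (f x) t).
Proof.
move=> linf a x y; rewrite !tliftM scaler_sumr -big_split.
apply: eq_bigr => i _ /=; rewrite scaler_sumr -big_split.
by apply: eq_bigr => j _ /=; rewrite linf scalerDr !scalerA mulrC.
Qed.

Lemma lfun_of U V (f : U -> V) : linear f -> {g : 'Hom(U, V) | g =1 f}.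
Proof.
move=> linf; pose FL := GRing.isLinear.Build _ _ _ _ f linf.
pose F : {linear U -> V} := HB.pack f FL.
by exists (linfun F) => u; rewrite lfunE.
Qed.

Lemma tliftZ U V W (f : U -> V -> W) x t :
  tlift (fun u v => x *: f u v) t = x *: tlift f t.
Proof.
have [g gE] : {g : 'Hom(W, W) | g =1 *:%R x}.
  by apply: lfun_of => y v w; rewrite scalerDr !scalerA mulrC.
by rewrite -gE lfun_tlift; apply: eq_tlift => u v; rewrite gE.
Qed.

Lemma tlift_mem U V W (f : U -> V -> W) (D : {vspace W}) t :
  (forall u v, f u v \in D) -> tlift f t \in D.
Proof.
move=> fD; rewrite tliftM; apply/memv_suml => i _; apply/memv_suml => j _.
by apply: memvZ.
Qed.

Lemma tensv_ind U V (D : {vspace U}) (E : {vspace V}) W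
  (g : 'Hom(tensor U V, W)) (F : {vspace W}) t :
  t \in tensorv D E ->
  (forall d e, d \in D -> e \in E -> g (tens d e) \in F) -> g t \in F.
Proof.
move=> tDE gF; rewrite memv_preim; apply: subvP t tDE.
apply/span_subvP => _ /allpairsP[[d e] /= [dD eE ->]].
by rewrite -memv_preim gF ?vbasis_mem.
Qed.

Lemma mem_tensorv U V (D : {vspace U}) (E : {vspace V}) d e :
  d \in D -> e \in E -> tens d e \in tensorv D E.
Proof.
move=> /coord_vbasis-> /coord_vbasis->.
pose e' := \sum_i coord (vbasis E) i e *: (vbasis E)`_i.
have [gl glE] := lfun_of (@tens_linearl k U V e').
rewrite -glE linear_sum; apply/memv_suml => i _; rewrite linearZ memvZ //= glE.
have [gr grE] := lfun_of (@tens_linearr k U V (vbasis D)`_i).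
rewrite -grE linear_sum; apply/memv_suml => j _; rewrite linearZ memvZ //= grE.
apply/memv_span/allpairsP; exists ((vbasis D)`_i, (vbasis E)`_j).
by split; rewrite //= mem_nth ?size_tuple.
Qed.

Lemma tlift_tens U V : tlift (@tens k U V) = \1%VF.
Proof.
apply: tlift_unique => u v; rewrite id_lfunE tliftE // => w.
  exact: tens_linearl.
exact: tens_linearr.
Qed.

Lemma tlift_sum U V W n (f : 'I_n -> U -> V -> W) t :
  tlift (fun u v => \sum_i f i u v) t = \sum_i tlift (f i) t.
Proof.
rewrite tliftM; under [RHS]eq_bigr do rewrite tliftM.
rewrite [RHS]exchange_big; apply: eq_bigr => i _ /=.
rewrite [RHS]exchange_big; apply: eq_bigr => j _ /=.
by rewrite scaler_sumr.
Qed.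

End TensorCalculus.

(** * The two actions of the dual algebra on a coalgebra *)

Section CoalgebraCalculus.
Variables (k : fieldType) (C : vectType k) (sC : coalgebra C).
Notation A := 'Hom(C, k^o).
Implicit Types (a b : A) (c d : C).
Local Notation Delta := (comul sC).

(** Coassociativity as it is used in Sweedler notation: a trilinear expression
in c1, c2, c3 does not depend on which leg of Delta c is split again. *)
Lemma coassoc (W : vectType k) (f : C -> C -> C -> W) c :
  (forall u v, linear (f u v)) ->
  (forall u w, linear (fun v => f u v w)) ->
  (forall v w, linear (fun u => f u v w)) ->
  tlift (fun u w => tlift (fun u1 u2 => f u1 u2 w) (Delta u)) (Delta c) =
  tlift (fun u w => tlift (f u) (Delta w)) (Delta c).
Proof.
move=> lin3 lin2 lin1.
pose F : 'Hom(tensor C (tensor C C), W) := tlift (fun u => tlift (f u)).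
have FE u v w : F (tens u (tens v w)) = f u v w.
  rewrite /F tliftE ?tliftE // => [s|x]; last exact: linearP.
  by apply: tlift_linear => v' w'.
transitivity (F (tassoc C C C
    (tlift (fun u w => tens (Delta u) w) (Delta c)))).
  rewrite !lfun_tlift; apply: eq_tlift => u w.
  rewrite /tassoc tliftE => [|s|x].
  - by rewrite lfun_tlift; apply: eq_tlift => u1 u2; rewrite FE.
  - by move=> y w1 w2; rewrite !linearP.
  move=> y w1 w2; rewrite -linearP; congr (F _).
  apply: (tlift_linear (f := fun v u0 v0 => tens u0 (tens v0 v))).
  move=> u0 v0 z t1 t2.
  by rewrite tens_linearr tens_linearr.
rewrite comulA lfun_tlift; apply: eq_tlift => u w.
rewrite /F tliftE // => [s|x]; last exact: linearP.
by apply: tlift_linear => v' w'.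
Qed.

Lemma scalel_linear (W : vectType k) a (w : W) :
  linear (fun c => (a c : k) *: w).
Proof. by move=> x c d; rewrite linearP scalerDl scalerA. Qed.

(** The action c |-> a(c1) c2 of the dual algebra, often written c ↼ a; its
counterpart rhit is c |-> a(c2) c1, often written a ⇀ c. *)
Definition lhit a : 'End(C) :=
  (tlift (fun c d => (a c : k) *: d) \o Delta)%VF.

Definition rhit a : 'End(C) :=
  (tlift (fun c d => (a d : k) *: c) \o Delta)%VF.

Lemma lhitE a c : lhit a c = tlift (fun c d => (a c : k) *: d) (Delta c).
Proof. exact: comp_lfunE. Qed.

Lemma rhitE a c : rhit a c = tlift (fun c d => (a d : k) *: c) (Delta c).
Proof. exact: comp_lfunE. Qed.

Lemma lhit_tens a u v :
  tlift (fun c d : C => (a c : k) *: d) (tens u v) = (a u : k) *: v.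
Proof.
rewrite tliftE // => [w|w]; first exact: scalel_linear.
by move=> x c d; rewrite scalerDr !scalerA mulrC.
Qed.

Lemma rhit_tens a u v :
  tlift (fun c d : C => (a d : k) *: c) (tens u v) = (a v : k) *: u.
Proof.
rewrite tliftE // => [w|w]; last exact: scalel_linear.
by move=> x c d; rewrite scalerDr !scalerA mulrC.
Qed.

Lemma lhit_linear : linear lhit.
Proof.
move=> x a b; apply/lfunP => c.
rewrite add_lfunE scale_lfunE !lhitE.
apply: (@tlift_linear k _ _ _ A (fun a c d => (a c : k) *: d)) => u v y a' b'.
by rewrite add_lfunE scale_lfunE scalerDl scalerA.
Qed.

Lemma rhit_linear : linear rhit.
Proof.
move=> x a b; apply/lfunP => c.
rewrite add_lfunE scale_lfunE !rhitE.
apply: (@tlift_linear k _ _ _ A (fun a c d => (a d : k) *: c)) => u v y a' b'.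
by rewrite add_lfunE scale_lfunE scalerDl scalerA.
Qed.

Lemma convE a b c :
  conv sC a b c = tlift (fun u v => (a u : k) * b v : k^o) (Delta c).
Proof. exact: comp_lfunE. Qed.

(** In a(c1) b(c2) either factor can be absorbed into the argument of the other
one, which turns the convolution product into the two actions. *)
Lemma convEl a b c : conv sC a b c = b (lhit a c).
Proof.
by rewrite convE lhitE lfun_tlift; apply: eq_tlift => u v; rewrite linearZ.
Qed.

Lemma convEr a b c : conv sC a b c = a (rhit b c).
Proof.
rewrite convE rhitE lfun_tlift; apply: eq_tlift => u v.
by rewrite linearZ /= mulrC.
Qed.

Lemma lhit_counit c : lhit (counit sC) c = c.
Proof. by rewrite lhitE counitl. Qed.

Lemma rhit_counit c : rhit (counit sC) c = c.
Proof. by rewrite rhitE counitr. Qed.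

Lemma lhit_app (W : vectType k) (f : C -> W) a c : linear f ->
  f (lhit a c) = tlift (fun c1 c2 => (a c1 : k) *: f c2) (Delta c).
Proof.
move=> /lfun_of[g gE]; rewrite lhitE -gE lfun_tlift.
by apply: eq_tlift => c1 c2; rewrite linearZ /= gE.
Qed.

Lemma rhit_app (W : vectType k) (f : C -> W) a c : linear f ->
  f (rhit a c) = tlift (fun c1 c2 => (a c2 : k) *: f c1) (Delta c).
Proof.
move=> /lfun_of[g gE]; rewrite rhitE -gE lfun_tlift.
by apply: eq_tlift => c1 c2; rewrite linearZ /= gE.
Qed.

(** Delta (c ↼ a) = (c1 ↼ a) ⊗ c2, as both sides are a(c1) c2 ⊗ c3.  With convEl
and convEr this makes C a bimodule over its dual algebra. *)
Lemma comul_lhit (W : vectType k) (f : C -> C -> W) a c :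
  (forall v, linear (f^~ v)) -> (forall u, linear (f u)) ->
  tlift f (Delta (lhit a c)) = tlift (fun u v => f (lhit a u) v) (Delta c).
Proof.
move=> linl linr.
rewrite lhitE !lfun_tlift.
under [RHS]eq_tlift => u v do rewrite (lhit_app a u (linl v)).
rewrite (coassoc (f := fun u1 u2 w => (a u1 : k) *: f u2 w)).
- by apply: eq_tlift => u v; rewrite tliftZ !linearZ.
- by move=> u v x w1 w2; rewrite linr scalerDr !scalerA mulrC.
- by move=> u v x w1 w2; rewrite linl scalerDr !scalerA mulrC.
by move=> u v; apply: scalel_linear.
Qed.

Lemma comul_rhit (W : vectType k) (f : C -> C -> W) a c :
  (forall v, linear (f^~ v)) -> (forall u, linear (f u)) ->
  tlift f (Delta (rhit a c)) = tlift (fun u v => f u (rhit a v)) (Delta c).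
Proof.
move=> linl linr.
rewrite rhitE !lfun_tlift.
under [RHS]eq_tlift => u v do rewrite (rhit_app a v (linr u)).
rewrite -(coassoc (f := fun u1 u2 w => (a w : k) *: f u1 u2)).
- by apply: eq_tlift => u v; rewrite tliftZ !linearZ.
- by move=> u v; apply: scalel_linear.
- by move=> u v x w1 w2; rewrite linr scalerDr !scalerA mulrC.
by move=> u v x w1 w2; rewrite linl scalerDr !scalerA mulrC.
Qed.

Lemma lhit_conv a b c : lhit (conv sC a b) c = lhit b (lhit a c).
Proof.
rewrite [RHS]lhitE comul_lhit => [|v|u].
- by rewrite lhitE; apply: eq_tlift => u v; rewrite convEl.
- exact: scalel_linear.
by move=> x v w; rewrite scalerDr !scalerA mulrC.
Qed.

Lemma rhit_conv a b c : rhit (conv sC a b) c = rhit a (rhit b c).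
Proof.
rewrite [RHS]rhitE comul_rhit => [|v|u].
- by rewrite rhitE; apply: eq_tlift => u v; rewrite convEr.
- by move=> x u w; rewrite scalerDr !scalerA mulrC.
exact: scalel_linear.
Qed.

Lemma lhit_rhit a b c : lhit a (rhit b c) = rhit b (lhit a c).
Proof.
rewrite [LHS]lhitE comul_rhit => [|v|u].
- by rewrite lhitE lfun_tlift; apply: eq_tlift => u v; rewrite linearZ.
- exact: scalel_linear.
by move=> x v w; rewrite scalerDr !scalerA mulrC.
Qed.

Lemma conv_linearl b : linear ((conv sC)^~ b).
Proof.
move=> x a a'; apply/lfunP => c.
by rewrite add_lfunE scale_lfunE !convEr add_lfunE scale_lfunE.
Qed.

Lemma comul_lhit_basis c :
  Delta c = \sum_i tens (std_basis i) (lhit (std_dual i) c).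
Proof.
rewrite -[LHS]id_lfunE -tlift_tens.
transitivity (tlift (fun u v =>
    \sum_i tens (std_basis i) ((std_dual i u : k) *: v)) (Delta c)).
  apply: eq_tlift => u v; rewrite {1}(std_basisE u).
  have [g gE] := lfun_of (@tens_linearl k C C v); rewrite -gE linear_sum.
  apply: eq_bigr => i _; rewrite linearZ /= gE std_dualE.
  have [h hE] := lfun_of (@tens_linearr k C C (std_basis i)).
  by rewrite -!hE linearZ.
rewrite tlift_sum; apply: eq_bigr => i _.
have [h hE] := lfun_of (@tens_linearr k C C (std_basis i)).
by rewrite lhitE -hE lfun_tlift; apply: eq_tlift => u v; rewrite hE.
Qed.

Lemma comul_rhit_basis c :
  Delta c = \sum_i tens (rhit (std_dual i) c) (std_basis i).
Proof.
rewrite -[LHS]id_lfunE -tlift_tens.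
transitivity (tlift (fun u v =>
    \sum_i tens ((std_dual i v : k) *: u) (std_basis i)) (Delta c)).
  apply: eq_tlift => u v; rewrite {1}(std_basisE v).
  have [g gE] := lfun_of (@tens_linearr k C C u); rewrite -gE linear_sum.
  apply: eq_bigr => i _; rewrite linearZ /= gE std_dualE.
  have [h hE] := lfun_of (@tens_linearl k C C (std_basis i)).
  by rewrite -!hE linearZ.
rewrite tlift_sum; apply: eq_bigr => i _.
have [h hE] := lfun_of (@tens_linearl k C C (std_basis i)).
by rewrite rhitE -hE lfun_tlift; apply: eq_tlift => u v; rewrite hE.
Qed.

(** The bases expand Delta c with one leg in the lhit-orbit of c, or the other
in its rhit-orbit.  A subspace stable under both therefore has its
comultiplication in D ⊗ C and in C ⊗ D, whose intersection is D ⊗ D. *)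
Lemma subcoalgebraP (D : {vspace C}) :
  subcoalgebra sC D <->
  forall a c, c \in D -> lhit a c \in D /\ rhit a c \in D.
Proof.
split=> [/subvP sD a c cD|stD].
  have DcD : Delta c \in tensorv D D by rewrite sD ?memv_img.
  split; [rewrite lhitE | rewrite rhitE]; apply: tensv_ind DcD _ => d e dD eD.
    by rewrite lhit_tens memvZ.
  by rewrite rhit_tens memvZ.
apply/subvP => _ /memv_imgP[c cD ->].
(* This puts Delta c in D ⊗ C; the other leg is treated afterwards. *)
have proj_comul : tlift (fun u v => tens (projv D u) v) (Delta c) = Delta c.
  rewrite {1}comul_rhit_basis [RHS]comul_rhit_basis linear_sum /=.
  apply: eq_bigr => i _; rewrite tliftE => [|v|u].
  - by rewrite projv_id //; have [] := stD (std_dual i) c cD.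
  - by move=> x u w; rewrite linearP tens_linearl.
  exact: tens_linearr.
rewrite -proj_comul {1}comul_lhit_basis linear_sum /=.
apply/memv_suml => i _; rewrite tliftE => [|v|u].
- by apply: mem_tensorv; [apply: memv_proj | have [] := stD (std_dual i) c cD].
- by move=> x u w; rewrite linearP tens_linearl.
exact: tens_linearr.
Qed.

End CoalgebraCalculus.

(** * Separable duals and cosemisimplicity *)

Section Separable.
Variables (k : fieldType) (C : vectType k) (sC : coalgebra C).
Notation A := 'Hom(C, k^o).
Local Notation lhit := (lhit sC).
Local Notation rhit := (rhit sC).

Definition separability_idempotent (e : tensor A A) : Prop :=
  tlift (conv sC) e = counit sC /\
  forall a, tlift (fun x y => tens (conv sC a x) y) e =
            tlift (fun x y => tens x (conv sC y a)) e.

Variables (e : tensor A A) (sep_e : separability_idempotent e).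

(** The identity a e = e a, read in an arbitrary bilinear expression in the
two legs of e. *)
Lemma balanced (W : vectType k) (f : A -> A -> W) a :
  (forall y, linear (f^~ y)) -> (forall x, linear (f x)) ->
  tlift (fun x y => f (conv sC a x) y) e =
  tlift (fun x y => f x (conv sC y a)) e.
Proof.
move=> linl linr; have /(congr1 (tlift f)) := sep_e.2 a.
rewrite !lfun_tlift; under eq_tlift do rewrite tliftE //.
by under [RHS]eq_tlift do rewrite tliftE //.
Qed.

Definition projector (D : {vspace C}) (p : 'End(C)) : Prop :=
  (forall c, p c \in D) /\ {in D, forall c, p c = c}.

Definition lcomm (p : 'End(C)) := forall a c, p (lhit a c) = lhit a (p c).
Definition rcomm (p : 'End(C)) := forall a c, p (rhit a c) = rhit a (p c).

(** Averages of p over the separability idempotent.  The legs enter lavg in the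
opposite order because lhit is a right action. *)
Definition ravg (p : 'End(C)) : 'End(C) :=
  tlift (fun x y => (rhit x \o p \o rhit y)%VF) e.
Definition lavg (p : 'End(C)) : 'End(C) :=
  tlift (fun x y => (lhit y \o p \o lhit x)%VF) e.

Lemma ravgE p c : ravg p c = tlift (fun x y => rhit x (p (rhit y c))) e.
Proof. by rewrite tlift_lfunE; apply: eq_tlift => x y; rewrite !comp_lfunE. Qed.

Lemma lavgE p c : lavg p c = tlift (fun x y => lhit y (p (lhit x c))) e.
Proof. by rewrite tlift_lfunE; apply: eq_tlift => x y; rewrite !comp_lfunE. Qed.

Lemma rhit_linear_app c : linear (fun a => rhit a c).
Proof. by move=> x a b; rewrite rhit_linear add_lfunE scale_lfunE. Qed.
Lemma lhit_linear_app c : linear (fun a => lhit a c).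
Proof. by move=> x a b; rewrite lhit_linear add_lfunE scale_lfunE. Qed.

Lemma ravg_rcomm p : rcomm (ravg p).
Proof.
move=> a c; rewrite !ravgE lfun_tlift.
under eq_tlift do rewrite -rhit_conv.
rewrite -(balanced (f := fun x y => rhit x (p (rhit y c)))).
- by apply: eq_tlift => x y; rewrite rhit_conv.
- by move=> y; apply: rhit_linear_app.
by move=> x z y y'; rewrite rhit_linear_app !linearP.
Qed.

Lemma lavg_lcomm p : lcomm (lavg p).
Proof.
move=> a c; rewrite !lavgE lfun_tlift.
under eq_tlift do rewrite -lhit_conv.
rewrite (balanced (f := fun x y => lhit y (p (lhit x c)))).
- by apply: eq_tlift => x y; rewrite lhit_conv.
- by move=> y z x x'; rewrite lhit_linear_app !linearP.
by move=> x; apply: lhit_linear_app.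
Qed.

(** The two actions commute, so averaging over one of them does not spoil
equivariance for the other. *)
Lemma lavg_rcomm p : rcomm p -> rcomm (lavg p).
Proof.
move=> comm_p a c; rewrite !lavgE lfun_tlift; apply: eq_tlift => x y.
by rewrite lhit_rhit comm_p lhit_rhit.
Qed.

(** On D the map p is the identity, so its average acts as the product of the
two legs of e, which is the unit of the dual algebra. *)
Lemma ravg_projector D p :
  subcoalgebra sC D -> projector D p -> projector D (ravg p).
Proof.
move=> /subcoalgebraP sD [pD pid]; split=> [c|c cD]; rewrite ravgE.
  by apply: tlift_mem => x y; have [] := sD x _ (pD (rhit y c)).
under eq_tlift => x y.
  rewrite pid; last by have [] := sD y c cD.
  rewrite -rhit_conv.
over.
rewrite -[RHS](rhit_counit sC) -sep_e.1.
have [g gE] := lfun_of (rhit_linear_app c).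
by rewrite -gE lfun_tlift; apply: eq_tlift => x y; rewrite gE.
Qed.

Lemma lavg_projector D p :
  subcoalgebra sC D -> projector D p -> projector D (lavg p).
Proof.
move=> /subcoalgebraP sD [pD pid]; split=> [c|c cD]; rewrite lavgE.
  by apply: tlift_mem => x y; have [] := sD y _ (pD (lhit x c)).
under eq_tlift => x y.
  rewrite pid; last by have [] := sD x c cD.
  rewrite -lhit_conv.
over.
rewrite -[RHS](lhit_counit sC) -sep_e.1.
have [g gE] := lfun_of (lhit_linear_app c).
by rewrite -gE lfun_tlift; apply: eq_tlift => x y; rewrite gE.
Qed.

(** The complement is the part of D in the kernel of the projection onto E,
averaged over both actions.  The equality of dimensions records that the sum
is direct. *)
Lemma subcoalgebra_complement (D E : {vspace C}) :
  subcoalgebra sC D -> subcoalgebra sC E -> (E <= D)%VS ->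
  exists2 E' : {vspace C}, subcoalgebra sC E' &
    (E + E' = D)%VS /\ (\dim E + \dim E' = \dim D)%N.
Proof.
move=> sD sE /subvP ED; pose p := lavg (ravg (projv E)).
have [pE pid] : projector E p.
  apply: lavg_projector => //; apply: ravg_projector => //.
  by split=> [c|c cE]; rewrite ?memv_proj ?projv_id.
have pl : lcomm p := lavg_lcomm (ravg (projv E)).
have pr : rcomm p := lavg_rcomm (@ravg_rcomm (projv E)).
have sumE : (E + (D :&: lker p) = D)%VS.
  apply: subv_anti; rewrite subv_add capvSl andbT; apply/andP; split.
    exact/subvP.
  apply/subvP => c cD; apply/memv_addP; exists (p c) => //.
  exists (c - p c); last by rewrite addrC subrK.
  rewrite memv_cap memv_ker linearB /= (pid (p c)) // subrr eqxx andbT.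
  by rewrite memvB // ED.
exists (D :&: lker p)%VS.
  apply/subcoalgebraP => a c; rewrite !memv_cap !memv_ker pl pr.
  move=> /andP[cD /eqP->]; have [cl cr] := (subcoalgebraP sC D).1 sD a c cD.
  by rewrite cl cr !linear0 eqxx.
split=> //; rewrite -dimv_disjoint_sum ?sumE //.
apply/eqP; rewrite -subv0; apply/subvP => c.
rewrite memv_cap memv_cap memv_ker memv0 => /and3P[cE _ /eqP].
by rewrite pid // => ->.
Qed.

(** Semisimplicity from complements, by induction on the dimension of D.  The
equality of dimensions again says that the sum is direct.  Simplicity
quantifies over all subspaces of D, so it is decided classically. *)
Lemma subcoalgebra_simple_sum (D : {vspace C}) : subcoalgebra sC D ->
  exists s : seq {vspace C},
    [/\ forall E, E \in s -> simple_subcoalgebra sC E,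
        (\sum_(E <- s) E)%VS = D & (\sum_(E <- s) \dim E)%N = \dim D].
Proof.
have [n] := ubnP (\dim D); elim: n D => // n IHn D ltDn sD.
have [->|nzD] := eqVneq D 0%VS.
  by exists [::]; rewrite !big_nil dimv0.
have [simD|nsimD] := classic (simple_subcoalgebra sC D).
  by exists [:: D]; rewrite !big_seq1; split=> // E; rewrite inE => /eqP->.
have [E [sE ED nzE neqED]] : exists E : {vspace C},
    [/\ subcoalgebra sC E, (E <= D)%VS, E != 0%VS & E != D].
  apply: NNPP => noE; apply: nsimD; split=> // [|E sE ED]; first exact/eqP.
  have [->|nzE] := eqVneq E 0%VS; [by left | right].
  by apply/eqP/negPn/negP => neqED; apply: noE; exists E.
have [E' sE' [sumE dimE]] := subcoalgebra_complement sD sE ED.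
have ltE : (\dim E < \dim D)%N.
  rewrite ltn_neqAle dimvS // andbT; apply: contraNneq neqED => eqd.
  by rewrite eqEdim ED eqd leqnn.
have ltE' : (\dim E' < \dim D)%N.
  by rewrite -dimE -[X in (X < _)%N]add0n ltn_add2r lt0n dimv_eq0.
have [s [ss sums dims]] := IHn E (leq_trans ltE ltDn) sE.
have [s' [ss' sums' dims']] := IHn E' (leq_trans ltE' ltDn) sE'.
exists (s ++ s'); rewrite !big_cat /= sums sums' dims dims'; split=> // F.
by rewrite mem_cat => /orP[/ss|/ss'].
Qed.

Lemma separable_cosemisimple : cosemisimple sC.
Proof.
have [|s [ss sums dims]] := @subcoalgebra_simple_sum fullv.
  by apply/subcoalgebraP => a c _; rewrite !memvf.
rewrite (big_nth 0%VS) big_mkord in sums.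
rewrite (big_nth 0%VS) big_mkord in dims.
exists (size s), (fun i => nth 0%VS s i); split=> // [i|].
  exact/ss/mem_nth.
by rewrite directvE /= sums dims.
Qed.

End Separable.

(** * The pairing of a tensor product of dual spaces *)

Section Pairing.
Variable k : fieldType.
Implicit Types U V W : vectType k.

Lemma eq_tens U V W (f g : tensor U V -> W) : linear f -> linear g ->
  (forall u v, f (tens u v) = g (tens u v)) -> f =1 g.
Proof.
move=> /lfun_of[F FE] /lfun_of[G GE] eqfg t; rewrite -FE -GE.
by congr (fun_of_lfun _ t); apply: tlift_unique => u v; rewrite FE GE.
Qed.

Lemma std_dual_basis V (f : 'Hom(V, k^o)) :
  f = \sum_i (f (std_basis i) : k) *: std_dual i.
Proof.
apply/lfunP => v; rewrite [in LHS](std_basisE v) linear_sum sum_lfunE.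
apply: eq_bigr => i _; rewrite linearZ scale_lfunE /= std_dualE.
exact: mulrC.
Qed.

Lemma lfun_sep V (u v : V) : (forall a : 'Hom(V, k^o), a u = a v) -> u = v.
Proof.
move=> eq_uv; rewrite (std_basisE u) (std_basisE v).
by apply: eq_bigr => i _; rewrite -!std_dualE eq_uv.
Qed.

Lemma tpairE U V (t : tensor 'Hom(U, k^o) 'Hom(V, k^o)) u v :
  tpair t u v =
  tlift (fun (f : 'Hom(U, k^o)) (g : 'Hom(V, k^o)) => (f u : k) *: g) t v.
Proof.
rewrite tlift_lfunE /tpair; apply: (eq_tlift (W := k^o)) => f g.
by rewrite scale_lfunE.
Qed.

(** Expansion in the dual bases; it makes the pairing nondegenerate. *)
Lemma tpair_lfun U V (t : tensor 'Hom(U, k^o) 'Hom(V, k^o)) :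
  t = \sum_i \sum_j tpair t (std_basis i) (std_basis j) *:
        tens (std_dual i) (std_dual j).
Proof.
rewrite -[LHS]id_lfunE -tlift_tens.
transitivity (tlift (fun (f : 'Hom(U, k^o)) (g : 'Hom(V, k^o)) =>
   \sum_i \sum_j ((f (std_basis i) : k) * g (std_basis j)) *:
        tens (std_dual i) (std_dual j)) t).
  apply: eq_tlift => f g; rewrite {1}(std_dual_basis f).
  have [l lE] := lfun_of (@tens_linearl k 'Hom(U, k^o) 'Hom(V, k^o) g).
  rewrite -lE linear_sum; apply: eq_bigr => i _; rewrite linearZ /= lE.
  rewrite {1}(std_dual_basis g).
  have [r rE] :=
    lfun_of (@tens_linearr k 'Hom(U, k^o) 'Hom(V, k^o) (std_dual i)).
  rewrite -rE linear_sum scaler_sumr; apply: eq_bigr => j _.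
  by rewrite linearZ /= rE scalerA.
rewrite tlift_sum; apply: eq_bigr => i _.
rewrite tlift_sum; apply: eq_bigr => j _.
have [s sE] : {s : 'Hom(k^o, tensor 'Hom(U, k^o) 'Hom(V, k^o)) |
    forall x : k, s x = x *: tens (std_dual i) (std_dual j)}.
  by apply: lfun_of => x y z; rewrite scalerDl scalerA.
by rewrite /tpair -sE lfun_tlift; apply: eq_tlift => f g; rewrite sE.
Qed.

Lemma tpair_inj U V (s t : tensor 'Hom(U, k^o) 'Hom(V, k^o)) :
  (forall u v, tpair s u v = tpair t u v) -> s = t.
Proof.
move=> eqst; rewrite (tpair_lfun s) (tpair_lfun t).
by apply: eq_bigr => i _; apply: eq_bigr => j _; rewrite eqst.
Qed.

Lemma tpair_linear U V u v :
  linear (fun t : tensor 'Hom(U, k^o) 'Hom(V, k^o) => tpair t u v : k^o).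
Proof. by move=> x s t; rewrite /tpair linearP. Qed.

Lemma tpair_linearl U V (t : tensor 'Hom(U, k^o) 'Hom(V, k^o)) v :
  linear (fun u => tpair t u v : k^o).
Proof.
apply: (tlift_linear (f := fun u (f : 'Hom(U, k^o)) (g : 'Hom(V, k^o)) =>
  (f u : k) * g v : k^o)) => f g x u u'.
by rewrite linearP mulrDl -mulrA.
Qed.

Lemma tpair_linearr U V (t : tensor 'Hom(U, k^o) 'Hom(V, k^o)) u :
  linear (fun v => tpair t u v : k^o).
Proof. by move=> x v v'; rewrite !tpairE linearP. Qed.

End Pairing.

(** * Integrals on a cosemisimple Hopf algebra *)

Section Integral.
Variables (k : fieldType) (H : falgType k) (sH : hopf_algebra H).

(** A normalised right integral of H^*: by convEr the second condition says
that L * a = a(1) L, and evaluation at 1 is the counit of H^*. *)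
Definition integral (L : 'Hom(H, k^o)) : Prop :=
  L 1 = 1 /\ forall a h, L (rhit sH a h) = (a 1 : k) * L h.

Lemma lhit1 a : lhit sH a 1 = (a 1 : k) *: 1.
Proof. by rewrite lhitE comul1 lhit_tens. Qed.

Lemma rhit1 a : rhit sH a 1 = (a 1 : k) *: 1.
Proof. by rewrite rhitE comul1 rhit_tens. Qed.

(** Let d be the component of 1 in a simple summand.  Projecting
rhit a 1 = a(1) 1 to that summand gives rhit a d = a(1) d for all a, which
forces d = counit(d) 1.  As the counits of the components add up to 1, some
component is a nonzero multiple of 1; its summand contains the subcoalgebra
k1, hence equals it by simplicity. *)
Lemma cosemisimple_integral : cosemisimple sH -> exists L, integral L.
Proof.
move=> [n [D [simD dirD sumD]]].
pose pi i : 'End(H) := sumv_pi_for (esym sumD) i.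
have piD i h : pi i h \in D i by apply: memv_sum_pi.
have pi_sum h : \sum_i pi i h = h by apply: sumv_pi_sum; rewrite ?memvf.
have piE i j h : h \in D j -> pi i h = if i == j then h else 0.
  move=> hD; pose c l := if l == j then h else 0.
  have sum_c : \sum_l c l = h.
    by rewrite (bigD1 j) //= big1 /c ?eqxx ?addr0 // => l /negPf->.
  have /directv_sum_unique/(_ (pi^~ h) c) := dirD.
  rewrite pi_sum sum_c eqxx => /(_ _ _)/esym/forallP eq_pi.
  apply/eqP/eq_pi=> // l _.
  by rewrite /c; case: eqP => [->|_]; rewrite ?mem0v.
have sD i a h : rhit sH a (pi i h) \in D i.
  by have [/subcoalgebraP sDi _ _] := simD i; have [] := sDi a _ (piD i h).
have pi_rhit i a h : pi i (rhit sH a h) = rhit sH a (pi i h).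
  rewrite -[in LHS](pi_sum h) !linear_sum (bigD1 i) //= big1 ?addr0 => [|j ij].
    by rewrite (piE _ _ _ (sD i a h)) eqxx.
  by rewrite (piE _ _ _ (sD j a h)) eq_sym (negPf ij).
(* Both sides have the same image a(1) counit(pi i 1) under any a, as
   counit(c1) a(c2) = a(c). *)
have pi1 i : pi i 1 = (counit sH (pi i 1) : k) *: 1.
  apply: lfun_sep => a; rewrite linearZ /=.
  rewrite -[in LHS](lhit_counit sH (pi i 1)) -convEl convEr -pi_rhit rhit1.
  by rewrite !linearZ /=; apply: mulrC.
have [i nz_i] : exists i, counit sH (pi i 1) != 0.
  have [i nz_i|all0] := pickP (fun i => counit sH (pi i 1) != 0).
    by exists i.
  have /eqP := counit1 sH; rewrite -(pi_sum 1) linear_sum big1.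
    by rewrite eq_sym oner_eq0.
  by move=> i _; apply/eqP/negbFE/all0.
have D1 : 1 \in D i.
  suff <- : (counit sH (pi i 1) : k)^-1 *: pi i 1 = 1 by rewrite memvZ.
  by rewrite {2}pi1 scalerA mulVf ?scale1r.
have eqDi : <[1]>%VS = D i.
  have [_ _ minDi] := simD i; have [||/eqP|//] := minDi <[1]>%VS.
  - apply/subcoalgebraP => a _ /vlineP[x ->].
    by rewrite !linearZ /= lhit1 rhit1 !memvZ ?memv_line.
  - by rewrite -memvE.
  by rewrite -subv0 -memvE memv0 oner_eq0.
exists (counit sH \o pi i)%VF; split=> [|a h].
  by rewrite comp_lfunE (piE _ _ _ D1) eqxx counit1.
rewrite [LHS]comp_lfunE pi_rhit [in RHS]comp_lfunE; have: pi i h \in D i by [].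
rewrite -eqDi => /vlineP[x ->].
by rewrite !linearZ /= rhit1 !linearZ /= counit1.
Qed.

End Integral.

(** * The Galois map and the separability idempotent *)

Section Galois.
Variables (k : fieldType) (H : falgType k) (sH : hopf_algebra H).
Variables (C : vectType k) (sC : module_coalgebra sH C).
Notation A := 'Hom(C, k^o).
Notation Hd := 'Hom(H, k^o).
Local Notation act := (mc_module sC).

Lemma tmap2_tlift (U1 U2 U3 V1 V2 V3 W : vectType k) (f : U1 -> U2 -> U3)
    (g : V1 -> V2 -> V3) (F : U3 -> V3 -> W) x y :
  (forall v, linear (F^~ v)) -> (forall u, linear (F u)) ->
  tlift F (tmap2 f g x y) =
  tlift (fun u1 v1 => tlift (fun u2 v2 => F (f u1 u2) (g v1 v2)) y) x.
Proof.
move=> linl linr; rewrite /tmap2 lfun_tlift; apply: eq_tlift => u1 v1.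
by rewrite lfun_tlift; apply: eq_tlift => u2 v2; rewrite tliftE.
Qed.

Lemma coaction_linear : linear (coaction sC).
Proof.
move=> x a b; apply/esym/coaction_unique => h c.
by rewrite tpair_linear !coactionE add_lfunE scale_lfunE.
Qed.

(** By duality the Galois map is (x ⊗ y)(h ⊗ c) = x(c1) y(h c2), which no
longer mentions the coaction. *)
Lemma galois_map_tens x y h c :
  tpair (galois_map sC (tens x y)) h c =
  tlift (fun c1 c2 => (x c1 : k) * y (act h c2) : k^o) (comul sC c).
Proof.
have conv1 (u : Hd) : conv sH (counit sH) u = u.
  by apply/lfunP => g; rewrite convEl lhit_counit.
pose G (x y : A) : tensor Hd A :=
  tlift (fun (u : Hd) (v : A) => tens u (conv sC x v)) (coaction sC y).
have galoisE : galois_map sC (tens x y) = G x y.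
  have GE x' y' : tmap2 (conv sH) (conv sC) (tens (counit sH) x')
       (coaction sC y') = G x' y'.
    rewrite /tmap2 tliftE => [|v|u].
    - by apply: eq_tlift => u v; rewrite conv1.
    - apply: tlift_linear => u2 v2 z u u'.
      by rewrite conv_linearl tens_linearl.
    apply: tlift_linear => u2 v2 z w w'.
    by rewrite conv_linearl tens_linearr.
  rewrite /galois_map tliftE => [|y'|x' z y1 y2]; first exact: GE.
    by move=> z x1 x2; rewrite tens_linearr /tmap2 linearP.
  by rewrite !GE /G coaction_linear linearP.
rewrite galoisE.
have [g gE] := lfun_of (tpair_linear h c).
rewrite -gE lfun_tlift.
transitivity (tlift (fun (u : Hd) (v : A) => tlift (fun c1 c2 =>
    (x c1 : k) * ((u h : k) * v c2) : k^o) (comul sC c)) (coaction sC y)).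
  apply: (eq_tlift (W := k^o)) => u v; rewrite gE tpair_tens convE -[LHS]tliftZ.
  by apply: (eq_tlift (W := k^o)) => c1 c2; rewrite mulrCA.
rewrite tlift_exchange; apply: (eq_tlift (W := k^o)) => c1 c2.
by rewrite tliftZ -coactionE.
Qed.

Lemma tpair_galois_map t h c :
  tpair (galois_map sC t) h c =
  tlift (fun c1 c2 => tpair t c1 (act h c2) : k^o) (comul sC c).
Proof.
move: t; apply: (eq_tens (W := k^o)
  (f := fun t => tpair (galois_map sC t) h c)) => [x t s|x t s|x y].
- by rewrite linearP tpair_linear.
- exact: (tlift_linear (f := fun t c1 c2 => tpair t c1 (act h c2) : k^o)
    _ (fun c1 c2 => @tpair_linear _ C C c1 (act h c2))).
rewrite galois_map_tens; apply: (eq_tlift (W := k^o)) => c1 c2.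
by rewrite [RHS]tpair_tens.
Qed.

(** The defining equation of e reads e(c1, h c2) = L(h) counit(c).  At h = 1 it
is the unit condition.  The elements a e and e a have the same image L ⊗ a
under the Galois map: for a e this follows from
a(c1) e(c2, h c3) = a(c1) L(h) counit(c2), and for e a from
e(c1, h1 c2) a(h2 c3) = L(h1) a(h2 c) = L(h) a(c), where the last step is the
integral property applied to the functional h |-> a(h c). *)
Lemma galois_separable (L : Hd) (e : tensor A A) :
  integral sH L -> injective (galois_map sC) ->
  galois_map sC e = tens L (counit sC) -> separability_idempotent sC e.
Proof.
move=> [L1 intL] injG Ge.
have Gpair h c :
    tlift (fun c1 c2 => tpair e c1 (act h c2) : k^o) (comul sC c) =
    (L h : k) * counit sC c.
  by rewrite -tpair_galois_map Ge tpair_tens.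
split=> [|a].
  apply/lfunP => c; rewrite tlift_lfunE.
  under eq_tlift do rewrite convE.
  rewrite tlift_exchange.
  have := Gpair 1 c; rewrite L1 mul1r => <-.
  by apply: (eq_tlift (W := k^o)) => u v; rewrite hact1.
apply: injG; apply: tpair_inj => h c.
have [ac acE] : {ac : Hd | forall g, ac g = a (act g c)}.
  by apply: lfun_of => x g g'; rewrite linearP /= add_lfunE scale_lfunE linearP.
transitivity ((L h : k) * a c); rewrite tpair_galois_map.
  transitivity (tlift (fun u v => tpair e (lhit sC a u) (act h v) : k^o)
                  (comul sC c)).
    apply: (eq_tlift (W := k^o)) => u v; rewrite /tpair lfun_tlift.
    apply: (eq_tlift (W := k^o)) => x y.
    by rewrite [LHS]tpair_tens convEl.
  rewrite -(comul_lhit sC (f := fun u v => tpair e u (act h v) : k^o)).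
  - by rewrite Gpair -convEl /= convEr rhit_counit.
  - by move=> v; apply: tpair_linearl.
  by move=> u x v v'; rewrite linearP tpair_linearr.
apply: esym.
transitivity (tlift (fun u v => tpair e u (rhit sC a (act h v)) : k^o)
                (comul sC c)).
  apply: (eq_tlift (W := k^o)) => u v; rewrite /tpair lfun_tlift.
  apply: (eq_tlift (W := k^o)) => x y.
  by rewrite [LHS]tpair_tens convEr.
transitivity (tlift (fun u v => tlift (fun h1 h2 => tlift (fun v1 v2 =>
    (a (act h2 v2) : k) * tpair e u (act h1 v1) : k^o) (comul sC v))
    (comul sH h)) (comul sC c)).
  apply: (eq_tlift (W := k^o)) => u v.
  rewrite (rhit_app sC a (act h v) (tpair_linearr e u)).
  rewrite comul_act tmap2_tlift // => [w|w].
    by move=> x w1 w2; rewrite tpair_linearr scalerDr !scalerA mulrC.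
  exact: scalel_linear.
rewrite tlift_exchange.
transitivity (tlift (fun h1 h2 => (L h1 : k) * ac h2 : k^o) (comul sH h)).
  apply: (eq_tlift (W := k^o)) => h1 h2.
  rewrite -(coassoc sC (f := fun u v1 v2 =>
    (a (act h2 v2) : k) * tpair e u (act h1 v1) : k^o)) => [|u v|u w|v w].
  - transitivity (tlift (fun u w => (L h1 : k) *:
        (a \o act h2)%VF ((counit sC u : k) *: w)) (comul sC c)).
      apply: (eq_tlift (W := k^o)) => u w; rewrite [in RHS]comp_lfunE !linearZ.
      transitivity ((a (act h2 w) : k) * tlift (fun u1 u2 =>
        tpair e u1 (act h1 u2) : k^o) (comul sC u)); first exact: tliftZ.
      by rewrite Gpair mulrC -mulrA mulrCA.
    by rewrite tliftZ -lfun_tlift counitl comp_lfunE acE.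
  - by move=> x v1 v2; rewrite !linearP mulrDl -mulrA.
  - by move=> x v1 v2; rewrite linearP tpair_linearr mulrDr mulrCA.
  - by move=> x v1 v2; rewrite tpair_linearl mulrDr mulrCA.
by rewrite -convE convEr intL acE hact1 mulrC.
Qed.

End Galois.

Theorem corollary4p3 (k : closedFieldType) (H : falgType k)
    (sH : hopf_algebra H) (cosemisimpleH : cosemisimple sH)
    (C : vectType k) (sC : module_coalgebra sH C)
    (regularC : regular_iso (mc_module sC)) (galoisC : galois_extension sC) :
  cosemisimple sC.
Proof.
have [L intL] := cosemisimple_integral cosemisimpleH.
have [_ bijG] := galoisC; have [G' _ GK] := bijG.
exact: separable_cosemisimple (galois_separable intL (bij_inj bijG) (GK _)).
Qed.
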